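(* Let $M$ be a left $R$-module which is projective in $\sigma[M]$. Then the following conditions are equivalent: (a) $M$ is Gelfand. (b) $M$ is strongly harmonic and quasi-duo.
   Context: $R$ is an associative ring with identity; modules are unital left $R$-modules. A submodule $N\leq M$ is fully invariant if $f(N)\subseteq N$ for all $f\in\mathrm{End}_R(M)$; $\Lambda^{fi}(M)$ is the lattice of fully invariant submodules of $M$ ordered by inclusion. $Max(M)$ is the set of maximal submodules of $M$ and $Max^{fi}(M)$ is the set of coatoms (maximal proper elements) of $\Lambda^{fi}(M)$. $\sigma[M]$ is the full subcategory of $R$-Mod of all modules that embed in a quotient of some direct sum $M^{(X)}$. $M$ is $N$-projective if for every epimorphism $\rho\colon N\to X$ and every homomorphism $\alpha\colon M\to X$ there is $\beta\colon M\to N$ with $\rho\beta=\alpha$; $M$ is projective in $\sigma[M]$ if it is $N$-projective for every $N\in\sigma[M]$. For $N,L\leq M$ put $N_ML=\sum\{f(N)\mid f\in\mathrm{Hom}_R(M,L)\}$. $M$ is strongly harmonic (respectively Gelfand) if for every two distinct $N,L\in Max^{fi}(M)$ (respectively $N,L\in Max(M)$) there exist $N',L'\in\Lambda^{fi}(M)$ with $L'\nleq L$, $N'\nleq N$ and $L'_MN'=0$. $M$ is quasi-duo if $Max(M)\subseteq\Lambda^{fi}(M)$, i.e. every maximal submodule is fully invariant. *)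

(* Defs.v *)
From HB Require Import structures.
From mathcomp Require Import all_boot all_order all_algebra.
From mathcomp Require Import boolp classical_sets functions cardinality.

Set Implicit Arguments.
Unset Strict Implicit.
Unset Printing Implicit Defensive.

Import GRing.Theory.
Local Open Scope classical_set_scope.
Local Open Scope ring_scope.

(* [pzRingType]: the ring is neither assumed commutative nor nontrivial.      *)

Section DirectSum.
Variables (R : pzRingType) (X : Type) (M : lmodType R).

Definition fin_supp : {pred X -> M} :=
  fun f => `[< finite_set [set x | f x <> 0] >].

Fact fin_supp_submod_closed : submod_closed fin_supp.
Proof.
split=> [|a u v].
  rewrite unfold_in; apply/asboolP.
  by rewrite (_ : [set x | _] = set0) //; apply/seteqP; split=> x.
rewrite !unfold_in => /asboolP fu /asboolP fv; apply/asboolP.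
apply: (@sub_finite_set _ _ ([set x | u x <> 0] `|` [set x | v x <> 0])); last first.
  by rewrite finite_setU.
move=> x /= nz; have [u0|] := pselect (u x = 0); last by left.
right=> v0; apply: nz.
by rewrite -[LHS]/(a *: u x + v x) u0 v0 scaler0 addr0.
Qed.

HB.instance Definition _ :=
  GRing.isSubmodClosed.Build R (X -> M) fin_supp fin_supp_submod_closed.

(* The direct sum M^(X), as the submodule of M^X of the finitely supported    *)
(* families.                                                                  *)
Record dsum := DSum { dsum_fun : X -> M; _ : dsum_fun \in fin_supp }.

HB.instance Definition _ := [isSub for dsum_fun].
HB.instance Definition _ := [Choice of dsum by <:].
HB.instance Definition _ := [SubChoice_isSubLmodule of dsum by <:].

End DirectSum.

Section Projectivity.
Variables (R : pzRingType) (M : lmodType R).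

(* N belongs to sigma[M]; a quotient of M^(X) is given as the codomain Q of a *)
(* surjective linear map.                                                     *)
Definition in_sigma (N : lmodType R) : Prop :=
  exists (X : Type) (Q : lmodType R)
         (p : {linear dsum X M -> Q}) (i : {linear N -> Q}),
    range p = [set: Q] /\ injective i.

(* Epimorphisms of modules are the surjective linear maps.                    *)
Definition rel_projective (N : lmodType R) : Prop :=
  forall (X : lmodType R) (rho : {linear N -> X}) (alpha : {linear M -> X}),
    range rho = [set: X] ->
    exists beta : {linear M -> N}, rho \o beta =1 alpha.

Definition projective_in_sigma : Prop :=
  forall N : lmodType R, in_sigma N -> rel_projective N.

End Projectivity.

Section FullyInvariant.
Variables (R : pzRingType) (M : lmodType R).
Implicit Types N L : set M.

Definition submodule N : Prop := submod_closed [in N].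

Definition fully_invariant N : Prop :=
  submodule N /\ forall f : {linear M -> M}, f @` N `<=` N.

(* Coatoms of a family of subsets of M ordered by inclusion, whose greatest   *)
(* element is M.                                                              *)
Definition coatom (Lambda : set (set M)) N : Prop :=
  [/\ Lambda N, N <> [set: M] &
      forall K, Lambda K -> N `<=` K -> K = N \/ K = [set: M]].

Definition Max : set (set M) := coatom submodule.

Definition Maxfi : set (set M) := coatom fully_invariant.

(* The sum of a family of submodules: all finite sums of elements of members. *)
Definition sum_submod (F : set (set M)) : set M :=
  [set x | exists s : seq M,
     (forall y, y \in s -> exists2 N, F N & N y) /\ x = \sum_(y <- s) y].

(* N_M L; Hom_R(M, L) is identified with the endomorphisms of M whose image   *)
(* is contained in L.                                                         *)
Definition submod_prod N L : set M :=
  sum_submod [set f @` N | f in [set f : {linear M -> M} | range f `<=` L]].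

Definition separated_by_fi N L : Prop :=
  exists N' L', [/\ fully_invariant N', fully_invariant L',
    ~ (L' `<=` L), ~ (N' `<=` N) & submod_prod L' N' = [set 0]].

Definition strongly_harmonic : Prop :=
  forall N L, Maxfi N -> Maxfi L -> N <> L -> separated_by_fi N L.

Definition gelfand : Prop :=
  forall N L, Max N -> Max L -> N <> L -> separated_by_fi N L.

Definition quasi_duo : Prop := Max `<=` fully_invariant.

End FullyInvariant.

(* Main.v *)
Require Import Defs.
From mathcomp Require Import all_boot all_order all_algebra.
From HB Require Import structures.
From mathcomp Require Import ring_quotient.
From mathcomp Require Import boolp classical_sets cardinality.
From mathcomp Require Import fsbigop finmap.

Set Implicit Arguments.
Unset Strict Implicit.
Unset Printing Implicit Defensive.

Import GRing.Theory.
Local Open Scope classical_set_scope.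
Local Open Scope quotient_scope.
Local Open Scope ring_scope.

(** In a quasi-duo module the maximal submodules are coatoms of the lattice of
    fully invariant submodules, so strongly harmonic quasi-duo modules are
    Gelfand. The converse needs two facts, both using projectivity.

    Gelfand modules are quasi-duo. If a maximal submodule N is moved by an
    endomorphism f, then K = f^-1(N) is another maximal submodule
    ([Max_preim]). Separate N from K by fully invariant N', L'. Since L' is not
    inside K = f^-1(N) and f(L') is inside L', neither N' nor L' is inside N.
    As N + N' = M, projectivity lifts the projection M -> M/N to some
    g : M -> N' ([lift_into]); it is the identity modulo N, whereas
    g(L') <= L'_M N' = 0, so L' <= N, a contradiction.

    Coatoms of the fully invariant lattice are then maximal submodules. By the
    quasi-duo property it is enough to find one maximal submodule above a
    proper fully invariant N ([fi_sub_Max]). The argument adapts Bass's theorem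
    that a nonzero projective module has a maximal submodule. If there were none
    above N, then by Zorn's lemma every finitely generated submodule would be
    superfluous modulo N ([small_span]). Projectivity with respect to the sum
    map from the direct sum of the cyclic submodules Rm of M to M gives, for
    each x, an endomorphism h with h(x) = x and image in a finitely generated
    submodule ([local_unit]). Modulo N, the map 1 - h is therefore onto, hence
    split by projectivity, and its kernel is superfluous, hence zero. That
    kernel contains x, so x lies in N for every x. *)

(** * Submodules and quotients as modules *)

Section SubmoduleTypes.
Variables (R : pzRingType) (M : lmodType R) (N : set M) (subN : submodule N).

(** The proof argument lets instance inference recover the closure properties
    of [N] from the predicate. *)
Definition submod_pred of submodule N : {pred M} := [in N].

HB.instance Definition _ :=
  GRing.isSubmodClosed.Build R M (submod_pred subN)
    (subN : submod_closed (submod_pred subN)).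

Record submod := Submod { submod_val : M; _ : submod_val \in submod_pred subN }.

HB.instance Definition _ := [isSub for submod_val].
HB.instance Definition _ := [Choice of submod by <:].
HB.instance Definition _ := [SubChoice_isSubLmodule of submod by <:].

Definition quot_mod := Quotient.quot (submod_pred subN).
HB.instance Definition _ := GRing.Zmodule.on quot_mod.


Definition quot_proj : M -> quot_mod := \pi_quot_mod.

Lemma quot_proj_eq x y : quot_proj x = quot_proj y <-> N (x - y).
Proof.
rewrite /quot_proj; split=> [/eqP|Nxy].
  by rewrite -Quotient.idealrBE => /set_mem.
by apply/eqP; rewrite -Quotient.idealrBE; apply/mem_set.
Qed.

Lemma quot_proj_surj q : exists x, q = quot_proj x.
Proof. by exists (repr q); rewrite /quot_proj reprK. Qed.

Fact quot_projD : {morph quot_proj : x y / x + y}.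
Proof. by move=> x y; rewrite /quot_proj pi_addr. Qed.

Definition quot_scale (a : R) (q : quot_mod) := quot_proj (a *: repr q).

Fact quot_projZ a x : quot_scale a (quot_proj x) = quot_proj (a *: x).
Proof.
apply/quot_proj_eq; rewrite -scalerBr; apply/set_mem.
rewrite -[_ \in _]/(_ \in submod_pred subN) rpredZ //.
by apply/mem_set/quot_proj_eq; rewrite /quot_proj reprK.
Qed.

Fact quot_scaleA a b q : quot_scale a (quot_scale b q) = quot_scale (a * b) q.
Proof. by have [x ->] := quot_proj_surj q; rewrite !quot_projZ scalerA. Qed.

Fact quot_scale1 : left_id 1 quot_scale.
Proof.
by move=> q; have [x ->] := quot_proj_surj q; rewrite quot_projZ scale1r.
Qed.

Fact quot_scaleDr : right_distributive quot_scale +%R.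
Proof.
move=> a q r; have [x ->] := quot_proj_surj q.
have [y ->] := quot_proj_surj r.
by rewrite -quot_projD !quot_projZ scalerDr quot_projD.
Qed.

Fact quot_scaleDl q : {morph quot_scale^~ q : a b / a + b}.
Proof.
move=> a b; have [x ->] := quot_proj_surj q.
by rewrite !quot_projZ scalerDl quot_projD.
Qed.

HB.instance Definition _ := GRing.Zmodule_isLmodule.Build R quot_mod
  quot_scaleA quot_scale1 quot_scaleDr quot_scaleDl.

Fact quot_proj_linear : linear quot_proj.
Proof. by move=> a x y; rewrite quot_projD -quot_projZ. Qed.

HB.instance Definition _ :=
  GRing.isLinear.Build R M quot_mod *:%R quot_proj quot_proj_linear.

End SubmoduleTypes.

(** Packs a function with a proof of its linearity, so that linear maps can be
    built inside proofs. *)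
Section Lin.
Variables (R : pzRingType) (U V : lmodType R) (f : U -> V) (lf : linear f).
Definition lin of linear f := f.
HB.instance Definition _ := GRing.isLinear.Build R U V *:%R (lin lf) lf.
End Lin.

(** * Arithmetic of submodules *)

Lemma submoduleP (R : pzRingType) (M : lmodType R) (N : set M) :
  submodule N <-> N 0 /\ forall a x y, N x -> N y -> N (a *: x + y).
Proof.
split=> -[N0 NP]; split; try exact/mem_set; try exact/set_mem.
- by move=> a x y /mem_set Nx /mem_set Ny; apply/set_mem/NP.
- by move=> a x y /set_mem Nx /set_mem Ny; apply/mem_set/NP.
Qed.

Section Basics.
Variables (R : pzRingType) (M : lmodType R).
Implicit Types N L U : set M.

Lemma submodD N x y : submodule N -> N x -> N y -> N (x + y).
Proof.
by move=> /submoduleP[_ NP] Nx Ny; rewrite -[x]scale1r; apply: NP.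
Qed.

Lemma submodZ N a x : submodule N -> N x -> N (a *: x).
Proof.
by move=> /submoduleP[N0 NP] Nx; rewrite -[_ *: _]addr0; apply: NP.
Qed.

Lemma submodN N x : submodule N -> N x -> N (- x).
Proof. by move=> sN Nx; rewrite -scaleN1r; apply: submodZ. Qed.

Lemma submodB N x y : submodule N -> N x -> N y -> N (x - y).
Proof. by move=> sN Nx Ny; apply: submodD => //; apply: submodN. Qed.

Definition sum2 N L : set M := [set x | exists2 n, N n & L (x - n)].

Lemma submodule_sum2 N L : submodule N -> submodule L -> submodule (sum2 N L).
Proof.
move=> sN sL; apply/submoduleP; split.
  by exists 0; [case/submoduleP: sN|rewrite subr0; case/submoduleP: sL].
move=> a x y [n Nn Lx] [m Nm Ly]; exists (a *: n + m).
  by apply: submodD => //; apply: submodZ.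
rewrite (_ : _ - _ = a *: (x - n) + (y - m)).
  by apply: submodD => //; apply: submodZ.
by rewrite scalerBr opprD addrACA.
Qed.

Definition cyclic (m : M) : set M := [set x | exists a, x = a *: m].

Lemma submodule_cyclic m : submodule (cyclic m).
Proof.
apply/submoduleP; split; first by exists 0; rewrite scale0r.
by move=> a _ _ [b ->] [c ->]; exists (a * b + c); rewrite scalerA scalerDl.
Qed.

(** * Maximal submodules *)

(** Since M/U is cyclic, generated by m, the unions of chains of proper
    submodules above U are proper: they all miss m. *)
Lemma Max_over U m : submodule U -> sum2 U (cyclic m) = setT -> U <> setT ->
  exists2 W, Max W & U `<=` W.
Proof.
move=> sU UmT UnT.
have nUm : ~ U m.
  move=> Um; apply: UnT; apply/seteqP; split=> // x _.
  have : setT x by []. rewrite -UmT => -[n Un [a /(canRL (subrK _)) ->]].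
  by apply: submodD => //; apply: submodZ.
(* The submodules above U are encoded as U `|` A, and not as A itself, so    *)
(* that the empty chain, whose union is empty, needs no separate treatment.  *)
pose P A := submodule (U `|` A) /\ ~ A m.
have [A [[sA nAm] maxA]] : exists A, P A /\ forall B, A `<` B -> ~ P B.
  apply: Zorn_bigcup => F FP totF; split; last by move=> [A /FP[]].
  apply/submoduleP; split; first by left; case/submoduleP: sU.
  have incl A x : F A -> (U `|` A) x -> (U `|` \bigcup_(X in F) X) x.
    by move=> FA [|Ax]; [left|right; exists A].
  have sF A a x y : F A -> (U `|` A) x -> (U `|` A) y ->
      (U `|` \bigcup_(X in F) X) (a *: x + y).
    move=> FA Ax Ay; apply: (incl A) => //; have [sA _] := FP _ FA.
    by apply: submodD => //; apply: submodZ.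
  move=> a x y [Ux|[A FA Ax]] [Uy|[B FB By]].
  - by left; apply: submodD => //; apply: submodZ.
  - by apply: (sF B) => //; [left|right].
  - by apply: (sF A) => //; [right|left].
  - have [AB|BA] := totF _ _ FA FB.
      by apply: (sF B) => //; right => //; apply: AB.
    by apply: (sF A) => //; right => //; apply: BA.
exists (U `|` A); last by move=> x; left.
split=> //.
  by move=> AT; have : setT m by []; rewrite -AT => -[].
move=> K sK WK; have [Km|nKm] := pselect (K m).
  right; apply/seteqP; split=> // x _.
  have : setT x by []. rewrite -UmT => -[n Un [a /(canRL (subrK _)) ->]].
  apply: submodD => //; first exact: submodZ.
  by apply: WK; left.
left; apply/seteqP; split=> // x Kx; right; apply: contrapT => nAx.
apply: (maxA K).
  by split=> [y Ay|KA]; [apply: WK; right|apply/nAx/KA].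
split=> //; rewrite (_ : _ `|` _ = K) //.
by apply/seteqP; split=> y; [case=> // Uy; apply: WK; left|right].
Qed.

(** When no maximal submodule lies above N, finitely generated submodules are
    superfluous modulo N: if U contains N and U + Rm_1 + ... + Rm_k = M, then
    U = M. The generators are removed one by one, each of them by [Max_over]. *)
Lemma small_span N (s : seq M) U :
    (forall W, Max W -> ~ N `<=` W) -> submodule U -> N `<=` U ->
    (forall y, exists c : M -> R, U (y - \sum_(m <- s) c m *: m)) ->
  U = setT.
Proof.
move=> nomax; elim: s U => [|m s IHs] U sU NU gen.
  by apply/seteqP; split=> // y _; have [c] := gen y; rewrite big_nil subr0.
apply: contrapT => UnT.
have [|W maxW UW] := @Max_over U m sU _ UnT; last first.
  by apply: (nomax W) => // x /NU /UW.
apply: IHs.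
- exact: submodule_sum2 sU (submodule_cyclic m).
- move=> x Nx; exists x; first exact: NU.
  by exists 0; rewrite subrr scale0r.
move=> y; have [c Uc] := gen y; exists c.
exists (y - \sum_(x <- m :: s) c x *: x) => //.
by exists (c m); rewrite big_cons opprB addrC addrA subrK addrK.
Qed.

(** M / f^-1(N) embeds in the simple module M/N and is nonzero. *)
Lemma Max_preim N (f : {linear M -> M}) : Max N -> ~ f @` N `<=` N ->
  Max (f @^-1` N).
Proof.
move=> [sN NnT maxN] fN.
have sK : submodule (f @^-1` N).
  apply/submoduleP; split; rewrite /preimage /=.
    by rewrite linear0; case/submoduleP: sN.
  by move=> a x y Nx Ny; rewrite linearP; apply: submodD => //; apply: submodZ.
split=> // [KT|L sL KL].
  by apply: fN => _ [x _ <-]; have : setT x by []; rewrite -KT.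
have [LK|/existsNP[z /not_implyP[Lz nNz]]] := pselect (L `<=` f @^-1` N).
  by left; apply/seteqP.
right; apply/seteqP; split=> // y _.
have sfL : submodule (f @` L).
  apply/submoduleP; split.
    by exists 0; [case/submoduleP: sL|rewrite linear0].
  move=> a _ _ [u Lu <-] [v Lv <-]; exists (a *: u + v); last first.
    by rewrite linearP.
  by apply: submodD => //; apply: submodZ.
have [||NLT] := maxN _ (submodule_sum2 sN sfL).
- move=> x Nx; exists x => //; exists 0; last by rewrite linear0 subrr.
  by case/submoduleP: sL.
- move=> eN; case: nNz; rewrite /preimage /= -eN.
  exists 0; first by case/submoduleP: sN.
  by exists z; rewrite ?subr0.
have : setT (f y) by [].
rewrite -NLT => -[n Nn [u Lu fu]].
rewrite -[y](subrK u); apply: submodD => //; apply: KL.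
by rewrite /preimage /= linearB fu opprB addrC subrK.
Qed.

End Basics.

(** * Members of sigma[M] *)

Section Projective.
Variables (R : pzRingType) (M : lmodType R).
Implicit Types N L : set M.

Lemma in_sigma_sub (X : Type) (T : lmodType R) (i : {linear T -> dsum X M}) :
  injective i -> in_sigma M T.
Proof.
move=> inj_i; exists X, (dsum X M), idfun, i; split=> //.
by apply/seteqP; split=> // x _; exists x.
Qed.

Fact const_fin_supp (x : M) : (fun _ : unit => x) \in @fin_supp R unit M.
Proof.
by rewrite unfold_in; apply/asboolP; apply: finite_finset.
Qed.

Definition dsum_const (x : M) : dsum unit M := DSum (const_fin_supp x).

Fact dsum_const_linear : linear dsum_const.
Proof. by move=> a x y; apply: val_inj. Qed.

HB.instance Definition _ :=
  GRing.isLinear.Build R M (dsum unit M) *:%R dsum_const dsum_const_linear.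

Lemma in_sigma_inj (T : lmodType R) (i : {linear T -> M}) :
  injective i -> in_sigma M T.
Proof.
move=> inj_i; apply: (@in_sigma_sub unit _ (dsum_const \o i)) => x y /=.
by move=> /(congr1 (fun f => dsum_fun f tt)) /inj_i.
Qed.

(** * Lifting along projectivity *)

Hypothesis projM : projective_in_sigma M.

(** Projectivity applied to T -> M -> M/N, stated with elements of M so that
    its uses never mention the quotient. *)
Lemma lift_mod (T : lmodType R) (k : {linear T -> M}) N :
    in_sigma M T -> submodule N -> (forall y, exists z, N (k z - y)) ->
  exists g : {linear M -> T}, forall y, N (k (g y) - y).
Proof.
move=> sT sN kN.
have [|g gP] := projM sT (rho := quot_proj sN \o k) (quot_proj sN).
  apply/seteqP; split=> // q _; have [y ->] := quot_proj_surj q.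
  by have [z Nz] := kN y; exists z => //=; apply/quot_proj_eq.
by exists g => y; apply/(quot_proj_eq sN)/gP.
Qed.

Lemma lift_into N L : submodule N -> submodule L -> sum2 N L = setT ->
  exists2 g : {linear M -> M}, range g `<=` L & forall y, N (g y - y).
Proof.
move=> sN sL NLT.
have [|g gP] := @lift_mod _ (val : submod sL -> M) N (in_sigma_inj val_inj) sN.
  move=> y; have : setT y by []. rewrite -NLT => -[n Nn Ly].
  exists (Submod (mem_set Ly : _ \in submod_pred sL)) => /=.
  by rewrite addrAC subrr add0r; apply: submodN.
exists ((val : submod sL -> M) \o g) => // _ [y _ <-] /=.
by apply/set_mem/(valP (g y)).
Qed.

(** * Local units with finitely generated image *)

(** The direct sum of the cyclic submodules Rm, for m in M, inside M^(M). *)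
Definition cyclic_sum : set (dsum M M) :=
  [set f | forall m, cyclic m (dsum_fun f m)].

Lemma submodule_cyclic_sum : submodule cyclic_sum.
Proof.
apply/submoduleP; split=> [m|a f g cf cg m].
  by exists 0; rewrite scale0r.
have [_] := (submoduleP _).1 (submodule_cyclic m).
by apply; [apply: cf|apply: cg].
Qed.

Definition dsum_sum (f : dsum M M) : M := \sum_(m \in setT) dsum_fun f m.

Lemma dsum_sumE (f : dsum M M) (s : seq M) : uniq s ->
  (forall m, dsum_fun f m <> 0 -> m \in s) ->
  dsum_sum f = \sum_(m <- s) dsum_fun f m.
Proof.
move=> us fs; rewrite /dsum_sum [RHS]fsbig_seq //; apply/esym/fsbig_widen => //.
by move=> m [_ /= ms]; apply: contrapT => /fs.
Qed.

Lemma dsum_suppP (f : dsum M M) :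
  exists s : {fset M}, forall m, dsum_fun f m <> 0 -> m \in s.
Proof.
pose D := [set x | dsum_fun f x <> 0].
have /asboolP fD : `[< finite_set D >] := valP f.
by exists (fset_set D) => m fm; rewrite in_fset_set //; apply/mem_set.
Qed.

Fact dsum_sum_linear : linear dsum_sum.
Proof.
move=> a f g; have [s fs] := dsum_suppP f; have [t gt] := dsum_suppP g.
have [u fu] := dsum_suppP (a *: f + g).
pose v := (s `|` t `|` u)%fset.
rewrite !(@dsum_sumE _ v) ?fset_uniq //.
- by rewrite scaler_sumr -big_split.
- by move=> m /gt mt; rewrite !inE mt orbT.
- by move=> m /fs mt; rewrite !inE mt.
- by move=> m /fu mt; rewrite !inE mt orbT.
Qed.

HB.instance Definition _ :=
  GRing.isLinear.Build R (dsum M M) M *:%R dsum_sum dsum_sum_linear.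

(** A splitting of the sum map from the direct sum of the Rm to M expresses each
    y as the sum of the components of its image; h keeps the finitely many
    indices m at which the image of x has a nonzero component. *)
Lemma local_unit x : exists (h : {linear M -> M}) (s : seq M),
  h x = x /\ forall y, exists c : M -> R, h y = \sum_(m <- s) c m *: m.
Proof.
pose T := submod submodule_cyclic_sum.
have sT : in_sigma M T.
  by apply: (@in_sigma_sub M _ (val : T -> dsum M M)); apply: val_inj.
have s0 : submodule [set 0 : M].
  by apply/submoduleP; split=> // a y z -> ->; rewrite scaler0 addr0.
have [|g gP] := @lift_mod T (dsum_sum \o (val : T -> dsum M M)) [set 0] sT s0.
  move=> y.
  (* y is the image of the family supported at the index y with value y. *)
  pose f m := if m == y then y else 0.
  have ff : f \in @fin_supp R M M.
    rewrite unfold_in; apply/asboolP.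
    apply: (@sub_finite_set _ _ [set y]) => //.
    by move=> m /=; rewrite /f; case: eqP.
  have cf : DSum ff \in submod_pred submodule_cyclic_sum.
    apply/mem_set => m /=; rewrite /f; case: eqP => [->|_].
      by exists 1; rewrite scale1r.
    by exists 0; rewrite scale0r.
  exists (Submod cf) => /=; rewrite (@dsum_sumE _ [:: y]) //.
    by rewrite big_seq1 /= /f eqxx subrr.
  by move=> m /=; rewrite /f inE; case: eqP.
have {}gP y : dsum_sum (val (g y)) = y.
  by apply/eqP; rewrite -subr_eq0; apply/eqP/gP.
have [s xs] := dsum_suppP (val (g x)).
pose h y := \sum_(m <- s) dsum_fun (val (g y)) m.
have lh : linear h.
  by move=> a y z; rewrite /h scaler_sumr -big_split !linearP.
exists (lin lh), s; split.
  by rewrite -[RHS]gP (dsum_sumE (fset_uniq s) xs).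
move=> y; have /choice[c cP] : cyclic_sum (val (g y)).
  by apply/set_mem/(valP (g y)).
by exists c; apply: eq_bigr => m _.
Qed.

(** * Existence of maximal submodules and the quasi-duo property *)

(** Full invariance of N lets endomorphisms of M act on M/N, which is what makes
    the argument for N = 0 go through modulo N. *)
Lemma fi_sub_Max N :
  fully_invariant N -> N <> setT -> exists2 W, Max W & N `<=` W.
Proof.
move=> [sN fiN] NnT; apply: contrapT => nomax.
have {}nomax W : Max W -> ~ N `<=` W by move=> mW NW; apply: nomax; exists W.
have {}fiN (f : {linear M -> M}) y : N y -> N (f y).
  by move=> Ny; apply: fiN; exists y.
have N0 : N 0 by case/submoduleP: sN.
have [x nNx] : exists x, ~ N x.
  by apply/existsNP => NT; apply/NnT/seteqP; split=> // y _.
have [h [s [hx hs]]] := local_unit x.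
have sNim (k : {linear M -> M}) : submodule [set y | exists z, N (y - k z)].
  apply/submoduleP; split; first by exists 0; rewrite linear0 subrr.
  move=> a y y' [z Nz] [z' Nz']; exists (a *: z + z').
  rewrite linearP opprD addrACA -scalerBr.
  by apply: submodD => //; apply: submodZ.
have [d dE] : exists d : {linear M -> M}, forall y, d y = y - h y.
  have ld : linear (fun y => y - h y).
    by move=> a y z; rewrite linearP opprD addrACA -scalerBr.
  by exists (lin ld).
(* d = 1 - h is onto modulo N, because h has superfluous image. *)
have d_onto y : exists z, N (d z - y).
  have dT : [set y | exists z, N (y - d z)] = setT.
    apply: (small_span (s := s) nomax) => // [u Nu|u].
      by exists 0; rewrite linear0 subr0.
    by have [c cP] := hs u; exists c; exists u; rewrite -cP -dE subrr.
  have : setT y by []. rewrite -dT => -[z Nz]; exists z.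
  by rewrite -opprB; apply: submodN.
have [g gP] := lift_mod (@in_sigma_inj M idfun (@inj_id _)) sN d_onto.
(* g splits d modulo N. For each u, the element v = u - g (d u) is in the    *)
(* kernel of d modulo N, so v = h v modulo N lies in the superfluous image   *)
(* of h; thus g is onto modulo N.                                            *)
have gT : [set y | exists z, N (y - g z)] = setT.
  apply: (small_span (s := s) nomax) => // [u Nu|u].
    by exists 0; rewrite linear0 subr0.
  have [c cP] := hs (u - g (d u)); exists c; exists (d u).
  rewrite -cP addrAC -dE linearB -opprB.
  exact: submodN.
have : setT x by []. rewrite -gT => -[z Nxz].
(* x = g z modulo N with d x = 0, so z = d (g z) = 0 modulo N. *)
have Nz : N z.
  rewrite -[z](subKr (d (g z))); apply: submodB => //.
  have -> : d (g z) = - d (x - g z).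
    by rewrite linearB (dE x) hx subrr sub0r opprK.
  by apply: submodN => //; apply: fiN.
by apply: nNx; rewrite -[x](subrK (g z)); apply: submodD => //; apply: fiN.
Qed.

(** A maximal submodule N is prime for the product of fully invariant
    submodules, by [lift_into]; primeness contradicts the separation of N from
    its preimage under an endomorphism that moves it. *)
Lemma gelfand_quasi_duo : gelfand M -> quasi_duo M.
Proof.
move=> gelM N maxN; have [sN NnT mN] := maxN; split=> // f.
apply: contrapT => fN; have maxK := Max_preim maxN fN.
have NK : N <> f @^-1` N.
  by move=> NK; apply: fN => _ [x Nx <-]; rewrite NK in Nx.
have [N' [L' [[sN' _] [sL' fiL'] L'K N'N prod0]]] := gelM _ _ maxN maxK NK.
have [z Lz nNz] : exists2 z, L' z & ~ N z.
  apply: contrapT => L'N; apply: L'K => y Ly; apply: contrapT => nNfy.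
  by apply: L'N; exists (f y) => //; apply: fiL'; exists y.
have NN'T : sum2 N N' = setT.
  have [|NN'N|//] := mN _ (submodule_sum2 sN sN').
  - by move=> y Ny; exists y => //; rewrite subrr; case/submoduleP: sN'.
  - case: N'N => y Ny; rewrite -NN'N; exists 0; first by case/submoduleP: sN.
    by rewrite subr0.
have [g gN' gN] := lift_into sN sN' NN'T.
have gz0 : g z = 0.
  have : submod_prod L' N' (g z).
    exists [:: g z]; split; last by rewrite big_seq1.
    move=> y /[!inE] /eqP ->; exists (g @` L'); last by exists z.
    by exists g.
  by rewrite prod0.
by apply: nNz; rewrite -[z]opprK; apply: submodN => //; rewrite -sub0r -gz0.
Qed.

End Projective.

Theorem theorem5p10 (R : pzRingType) (M : lmodType R)
    (projM : projective_in_sigma M) :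
  gelfand M <-> strongly_harmonic M /\ quasi_duo M.
Proof.
split=> [gelM|[harM qdM] N L maxN maxL]; last first.
  have coatom_fi (K : set M) : Max K -> Maxfi K.
    move=> maxK; have [_ KnT mK] := maxK.
    by split=> // [|K' [sK' _]]; [exact: qdM|exact: mK].
  by apply: harM; exact: coatom_fi.
have qdM := gelfand_quasi_duo projM gelM.
have fi_Max (K : set M) : Maxfi K -> Max K.
  move=> [fiK KnT mK]; have [W maxW KW] := fi_sub_Max projM fiK KnT.
  by have [<-//|WT] := mK W (qdM W maxW) KW; case: maxW.
by split=> // N L maxN maxL; apply: gelM; exact: fi_Max.
Qed.
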